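(* For every integer $n\geqslant 0$, with $p=\lfloor (n+1)/2\rfloor$, $$\sum_{k=0}^{\lfloor n/2\rfloor}\ \sum_{q=0}^{k}\ \sum_{r=0}^{q}\binom{n-k}{r}=F_{n+5}-2^p\left(\frac12 p+\frac72+\frac{(-1)^n}{2}\right)$$ (an equality of rational numbers).
   Context: $(F_n)_{n\geqslant 0}$ denotes the Fibonacci numbers: $F_0=0$, $F_1=1$, and $F_{n+2}=F_{n+1}+F_n$ for all $n\geqslant 0$. *)

(* Defs.v *)
From mathcomp Require Import all_boot all_order all_algebra.

Set Implicit Arguments.
Unset Strict Implicit.
Unset Printing Implicit Defensive.

Fixpoint fib (n : nat) : nat :=
  match n with
  | 0 => 0
  | 1 => 1
  | (m.+1 as m1).+1 => fib m1 + fib m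
  end.

(* Main.v *)
Require Import Defs.
From mathcomp Require Import all_boot all_order all_algebra.
From mathcomp Require Import ring zify.

Set Implicit Arguments.
Unset Strict Implicit.
Unset Printing Implicit Defensive.

Import GRing.Theory.
Local Open Scope ring_scope.

(** Call an array [T m k] Pascal-like when it obeys Pascal's rule and has a
    constant column [k = 0]. The binomial array is Pascal-like, and replacing
    each row by its partial sums preserves the property; hence the inner double
    sum is an entry [T (n - k) k] of a Pascal-like array, and the left-hand side
    is the sum [S n] of [T] along a shallow diagonal.

    As for Pascal's triangle itself, Pascal's rule makes these diagonal sums
    satisfy Fibonacci's recurrence, up to a defect
    [S (n + 2) = S (n + 1) + S n + T h (h + 1)] when [n = 2h]: the diagonals of
    index [2h + 1] and [2h + 2] do not reach equally far, and the binomial array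
    hides this only because it vanishes there ([binomial h (h + 1) = 0]). For
    partial sums of partial sums of the binomials, the defect is computed from
    the row sums [2 ^ h]: it equals [2 ^ h * (h + 4) / 2] (lemma
    [psum_psum_bin_defect]). The right-hand side satisfies the same perturbed
    recurrence with the same initial values, so the two sides agree by induction
    on [h], treating [2h] and [2h + 1] together. *)

Section PascalLike.
Variable V : nmodType.
Implicit Types (T : nat -> nat -> V) (f : nat -> V).

Definition psum f k : V := \sum_(0 <= q < k.+1) f q.

Lemma psum0 f : psum f 0 = f 0%N.
Proof. exact: big_nat1. Qed.

Lemma psumS f k : psum f k.+1 = psum f k + f k.+1.
Proof. exact: big_nat_recr. Qed.

Definition pascal_like T :=
  (forall m, T m.+1 0%N = T m 0%N) /\
  (forall m k, T m.+1 k.+1 = T m k + T m k.+1).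

(** Summing Pascal's rule along a row leaves the leading entry [T (m + 1) 0]
    over; the constant first column turns it into the missing term [T m 0]. *)
Lemma pascal_like_psum T :
  pascal_like T -> pascal_like (fun m => psum (T m)).
Proof.
case=> T0 TS; split=> [m|m k]; first by rewrite !psum0.
elim: k => [|k IHk]; first by rewrite !psumS !psum0 T0 TS.
by rewrite psumS IHk TS addrACA -!psumS.
Qed.

Definition diag_sum T n : V := \sum_(0 <= k < (n./2).+1) T (n - k)%N k.

(** Pascal's rule splits the entries of the diagonal [n + 2], the first one
    excepted, into entries of the diagonals [n] and [n + 1]; the diagonal
    [n + 1] is met up to column [n./2 + 1], which may exceed [(n + 1)./2]. *)
Lemma diag_sum_pascal T n : pascal_like T ->
  diag_sum T n.+2 =
  \sum_(0 <= k < (n./2).+2) T (n.+1 - k)%N k + diag_sum T n.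
Proof.
case=> T0 TS; rewrite /diag_sum [LHS]big_nat_recl // [in RHS]big_nat_recl //.
rewrite !subn0 T0 -addrA; congr (_ + _); rewrite -big_split /=.
apply: eq_big_nat => k /andP[_ lt_k].
have -> : (n.+2 - k.+1)%N = (n - k).+1 by lia.
by rewrite TS subSS addrC.
Qed.

Lemma diag_sum_odd T h : pascal_like T ->
  diag_sum T (h.*2).+3 = diag_sum T (h.*2).+2 + diag_sum T (h.*2).+1.
Proof.
move=> T_pascal; rewrite diag_sum_pascal //; congr (_ + _).
by rewrite /diag_sum /= uphalf_double doubleK.
Qed.

Lemma diag_sum_even T h : pascal_like T ->
  diag_sum T (h.*2).+2 =
  diag_sum T (h.*2).+1 + T h h.+1 + diag_sum T h.*2.
Proof.
move=> T_pascal; rewrite diag_sum_pascal // big_nat_recr //= doubleK.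
rewrite /diag_sum /= uphalf_double.
by have -> : (h.*2.+1 - h.+1)%N = h by lia.
Qed.

End PascalLike.

Definition bin_array (m k : nat) : rat := ('C(m, k))%:R.

Lemma pascal_like_bin : pascal_like bin_array.
Proof.
by split=> [m|m k]; rewrite /bin_array ?bin0 // binS natrD addrC.
Qed.

Lemma psum_bin_full m k : (m <= k)%N -> psum (bin_array m) k = 2 ^+ m.
Proof.
have [_ PS] := pascal_like_psum pascal_like_bin.
elim: m k => [|m IHm] k.
  move=> _; elim: k => [|k IHk]; first by rewrite psum0.
  by rewrite psumS IHk /bin_array bin0n addr0.
case: k => // k; rewrite ltnS => le_mk.
by rewrite PS !IHm ?(leq_trans le_mk) // exprS; ring.
Qed.

(** By Pascal's rule, the entry [(h + 1, h + 2)] is the sum of the entries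
    [(h, h + 1)] and [(h, h + 2)], and these two differ by the full row sum
    [2 ^ h]; this gives a first-order recurrence in [h]. *)
Lemma psum_psum_bin_defect h :
  psum (psum (bin_array h)) h.+1 = 2 ^+ h * (h%:R + 4) / 2.
Proof.
have [_ PPS] := pascal_like_psum (pascal_like_psum pascal_like_bin).
elim: h => [|h IHh].
  by rewrite psumS psum0 !psum_bin_full // expr0; field.
rewrite PPS [X in _ + X]psumS IHh psum_bin_full; last by lia.
by rewrite exprS -natr1; field.
Qed.

Lemma fib_doubleS_add h k :
  fib (h.+1.*2 + k) = (fib (h.*2 + k.+1) + fib (h.*2 + k))%N.
Proof. by rewrite doubleS !addSn addnS. Qed.

(** The recurrence has order two, so both parities are carried together. *)
Lemma diag_sum_closed h (S := diag_sum (fun m => psum (psum (bin_array m)))) :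
  S h.*2 = (fib (h.*2 + 5))%:R - 2 ^+ h * (h%:R / 2 + 4) /\
  S (h.*2).+1 = (fib (h.*2 + 6))%:R - 2 ^+ h * (h%:R + 7).
Proof.
have TP := pascal_like_psum (pascal_like_psum pascal_like_bin).
elim: h => [|h [IHe IHo]].
  by rewrite /S /diag_sum !big_nat1 !psum0.
have even_step : S (h.+1.*2) =
    (fib (h.+1.*2 + 5))%:R - 2 ^+ h.+1 * (h.+1%:R / 2 + 4).
  rewrite fib_doubleS_add natrD doubleS /S diag_sum_even // -/S IHe IHo.
  by rewrite psum_psum_bin_defect !exprS -natr1; field.
split=> //; rewrite [LHS]diag_sum_odd // -/S -[in S _.+2]doubleS even_step IHo.
by rewrite [in RHS]fib_doubleS_add natrD doubleS !addSnnS !exprS -natr1; field.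
Qed.

Theorem theorem5 (n : nat) :
  let p : nat := (n + 1)./2 in
  \sum_(0 <= k < (n./2).+1) \sum_(0 <= q < k.+1) \sum_(0 <= r < q.+1)
      ('C(n - k, r))%:R
  = (fib (n + 5))%:R
    - 2 ^+ p * (1 / 2 * p%:R + 7 / 2 + (-1) ^+ n / 2) :> rat.
Proof.
move=> p; rewrite {}/p.
change (diag_sum (fun m => psum (psum (bin_array m))) n =
  (fib (n + 5))%:R - 2 ^+ (n + 1)./2 *
    (1 / 2 * ((n + 1)./2)%:R + 7 / 2 + (-1) ^+ n / 2)).
have [even_closed odd_closed] := diag_sum_closed n./2.
rewrite addn1 -signr_odd -[n in diag_sum _ n]odd_double_half.
rewrite -[in fib _](odd_double_half n) -uphalfE uphalf_half.
case: (odd n); rewrite !(add0n, add1n).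
- by rewrite odd_closed addSnnS exprS -natr1; field.
- by rewrite even_closed; field.
Qed.
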